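(* Let $X$ be a Fréchet sequence space over $\mathbb{Z}$ in which the unit sequences $(e_n)_{n\in\mathbb{Z}}$ form an unconditional basis. Let $w=(w_n)_{n\in\mathbb{Z}}$ be a sequence of non-zero scalars such that the bilateral weighted backward shift $B_w$, $B_w(x_n)_{n\in\mathbb{Z}}=(w_{n+1}x_{n+1})_{n\in\mathbb{Z}}$, is a (continuous linear) operator on $X$. Let $\mathcal{F}$ be a left-invariant and partition regular Furstenberg family. Suppose there exist $x\in X$ and a non-zero vector $y\in X$ such that, for every neighbourhood $V$ of $y$, \[ \{ n\geq 0 : B_w^n x \in V\} \in \mathcal{F}. \] Then for every integer $p\geq 0$ and every $0$-neighbourhood $W$ in $X$ there is a set $A\in\mathcal{F}$ such that \[ \sum_{n\in A} \frac{1}{\prod_{\nu=1}^{p+n} w_\nu}\,e_{p+n} \quad\text{converges in } X, \] and \[ \Big(\prod_{\nu=p-n+1}^{0} w_\nu\Big) e_{p-n} \in W \quad \text{for all } n\in A \text{ with } n\geq p \] (an empty product being $1$).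
   Context: A Fréchet sequence space over $\mathbb{Z}$ is a Fréchet space that is a linear subspace of the space $\mathbb{K}^{\mathbb{Z}}$ of all real or complex sequences indexed by $\mathbb{Z}$, such that each coordinate functional $x=(x_n)_{n\in\mathbb{Z}}\mapsto x_k$ is continuous; $e_n=(\delta_{n,k})_{k\in\mathbb{Z}}$. A Furstenberg family is a non-empty family $\mathcal{F}$ of subsets of $\mathbb{N}_0$, not containing the empty set, such that $A\in\mathcal{F}$ and $B\supset A$ imply $B\in\mathcal{F}$. It is left-invariant if $A\in\mathcal{F}$ and $n\geq 0$ imply $A-n:=\{k-n : k\in A, k\geq n\}\in\mathcal{F}$; it is partition regular if whenever $A\in\mathcal{F}$ and $A=A_1\cup A_2$, then $A_1\in\mathcal{F}$ or $A_2\in\mathcal{F}$. *)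

(* Defs.v *)
From HB Require Import structures.
From mathcomp Require Import all_boot all_order all_algebra.
From mathcomp Require Import all_classical all_reals all_analysis.
Set Implicit Arguments. Unset Strict Implicit. Unset Printing Implicit Defensive.
Import Order.TTheory GRing.Theory Num.Theory.
Import numFieldTopology.Exports numFieldNormedType.Exports.
Local Open Scope classical_set_scope.
Local Open Scope ring_scope.

(** Fréchet space: a (locally convex, by [tvsType]) topological vector space
    that is Hausdorff, metrizable (countable uniformity) and complete. *)
Definition frechet (K : numFieldType) (X : tvsType K) : Prop :=
  [/\ hausdorff_space X, countable_uniformity X &
      forall F : set_system X, ProperFilter F -> cauchy F -> exists l : X, F --> l].

(** [coord : int -> X -> K] realises X as a Fréchet sequence space over Z:
    x |-> (coord n x)_n is an injective linear map X -> K^Z with every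
    coordinate functional continuous. *)
Definition sequence_space (K : numFieldType) (X : tvsType K)
    (coord : int -> X -> K) : Prop :=
  [/\ forall n (a : K) (u v : X), coord n (a *: u + v) = a * coord n u + coord n v,
      forall u v : X, (forall n, coord n u = coord n v) -> u = v &
      forall n, continuous (coord n : X -> K^o)].

Definition unit_sequences (K : numFieldType) (X : tvsType K)
    (coord : int -> X -> K) (e : int -> X) : Prop :=
  forall n k, coord k (e n) = (k == n)%:R.

(** Unconditional convergence of sum_{n in Z} c n *: e n to x: convergence of
    the net of finite partial sums indexed by finite subsets of Z. *)
Definition uncond_sum (K : numFieldType) (X : tvsType K)
    (c : int -> K) (e : int -> X) (x : X) : Prop :=
  forall U, nbhs x U -> exists F0 : seq int,
    forall G : seq int, uniq G -> {subset F0 <= G} ->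
      U (\sum_(n <- G) c n *: e n).

(** The unit sequences form an unconditional basis: every x is the
    (unconditionally convergent) sum of sum_n x_n e_n. (Uniqueness of
    coefficients follows from continuity of the coordinate functionals.) *)
Definition uncond_basis (K : numFieldType) (X : tvsType K)
    (coord : int -> X -> K) (e : int -> X) : Prop :=
  unit_sequences coord e /\ forall x : X, uncond_sum (fun n => coord n x) e x.

Definition is_weighted_backward_shift (K : numFieldType) (X : tvsType K)
    (coord : int -> X -> K) (w : int -> K) (B : X -> X) : Prop :=
  (forall x n, coord n (B x) = w (n + 1) * coord (n + 1) x) /\ continuous B.

Definition furstenberg (F : set (set nat)) : Prop :=
  [/\ exists A, F A, ~ F set0 & forall A B, F A -> A `<=` B -> F B].

Definition left_invariant (F : set (set nat)) : Prop :=
  forall A n, F A -> F [set k | A (k + n)%N].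

Definition partition_regular (F : set (set nat)) : Prop :=
  forall A A1 A2, F A -> A = A1 `|` A2 -> F A1 \/ F A2.

Definition prod_int (K : numFieldType) (w : int -> K) (a b : int) : K :=
  if (a <= b)%R then \prod_(k < (`|b - a|%N).+1) w (a + k%:Z) else 1.

(* Main.v *)
Require Import Defs.
From HB Require Import structures.
From mathcomp Require Import all_boot all_order all_algebra.
From mathcomp Require Import all_classical all_reals all_analysis.
From mathcomp Require Import ring lra zify.
Set Implicit Arguments. Unset Strict Implicit. Unset Printing Implicit Defensive.
Import Order.TTheory GRing.Theory Num.Theory.
Import numFieldTopology.Exports numFieldNormedType.Exports.
Local Open Scope classical_set_scope.
Local Open Scope ring_scope.

(** Choose [j] with [y_j <> 0]; after replacing [x], [y] by [B^d x], [B^d y] we may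
    assume [j + s = p] with [s >= 0]. For all [n] in the return set [A] of a small
    neighbourhood of [y], the [j]-th coordinate [w_{j+1} ... w_{j+n} x_{j+n}] of [B^n x] is
    bounded away from [0], so [(w_{j+1} ... w_{j+n})^-1 e_{j+n}] is a bounded multiple of
    [x_{j+n} e_{j+n}], and its sum over [A] converges because bounded multipliers preserve
    unconditional convergence. If [m] is one fixed return time and [q = j + m - n], the
    [q]-th coordinate of [B^n x] is [w_{q+1} ... w_j] times the nonzero constant
    [(B^m x)_j]; the coordinate projections are equicontinuous (Baire) and [y_q e_q] tends
    to [0], hence [w_{q+1} ... w_j e_q] is small for large [n] in [A]. Applying a power of
    [B], shifting [A] to the left by [s] and dropping finitely many elements gives the claim.

    Over a general [numFieldType] the multiplier step needs the scalars to be almost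
    two-dimensional over the reals (Gelfand-Mazur-Ostrowski) if they are archimedean; if
    they are not, one infinite scalar absorbs all finite sums. *)

(** * The totally ordered field of real elements of [K] *)

Section RealPart.
Variable K : numFieldType.

(** The order of [K] may be partial, as for complex scalars. Bundling the real elements gives a
    [realFieldType] in which the norm of [K] takes its values. *)
Record realpart := RealPart { rval : K; rvalP : rval \is Num.real }.

HB.instance Definition _ := [isSub for rval].
HB.instance Definition _ := [Choice of realpart by <:].
HB.instance Definition _ := [SubChoice_isSubIntegralDomain of realpart by <:].
HB.instance Definition _ := [SubIntegralDomain_isSubField of realpart by <:].

Implicit Types x y : realpart.

Definition rle x y := rval x <= rval y.
Definition rlt x y := rval x < rval y.
Definition rnorm x : realpart := RealPart (normr_real (rval x)).

Fact rle0_add x y : rle 0 x -> rle 0 y -> rle 0 (x + y).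
Proof. exact: addr_ge0. Qed.

Fact rle0_mul x y : rle 0 x -> rle 0 y -> rle 0 (x * y).
Proof. exact: mulr_ge0. Qed.

Fact rle0_anti x : rle 0 x -> rle x 0 -> x = 0.
Proof. by move=> h1 h2; apply/val_inj/le_anti/andP. Qed.

Fact rsub_ge0 x y : rle 0 (y - x) = rle x y.
Proof. by rewrite /rle /= subr_ge0. Qed.

Fact rle0_total x : rle 0 x || rle x 0.
Proof. by case: x. Qed.

Fact rnormN x : rnorm (- x) = rnorm x.
Proof. by apply: val_inj; rewrite /= normrN. Qed.

Fact rge0_norm x : rle 0 x -> rnorm x = x.
Proof. by move=> h; apply/val_inj/ger0_norm. Qed.

Fact rlt_def x y : rlt x y = (y != x) && rle x y.
Proof. by rewrite /rlt lt_def. Qed.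

HB.instance Definition _ := Num.IntegralDomain_isLeReal.Build realpart
  rle0_add rle0_mul rle0_anti rsub_ge0 rle0_total rnormN rge0_norm rlt_def.

Lemma rval_le x y : (x <= y) = (\val x <= \val y).
Proof. by []. Qed.

End RealPart.

(** * Multiplicative norms over an archimedean field: approximate Gelfand-Mazur-Ostrowski *)

Section ArchimedeanNormedField.
Variables (R : realFieldType) (K : fieldType) (i : {rmorphism R -> K}) (N : K -> R).
Hypothesis arch : forall x : R, exists n : nat, x <= n%:R.
Hypothesis N_ge0 : forall x, 0 <= N x.
Hypothesis ND : forall x y, N (x + y) <= N x + N y.
Hypothesis NM : forall x y, N (x * y) = N x * N y.
Hypothesis Ni : forall r, N (i r) = `|r|.

Lemma nfN x : N (- x) = N x.
Proof. by rewrite -mulN1r -(rmorphN1 i) NM Ni normrN1 mul1r. Qed.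

Lemma nfB x y : N x - N y <= N (x + y).
Proof. by have := ND (x + y) (- y); rewrite addrK nfN; lra. Qed.

Lemma nfX x n : N (x ^+ n) = N x ^+ n.
Proof.
elim: n => [|n IH]; first by rewrite !expr0 -(rmorph1 i) Ni normr1.
by rewrite !exprS NM IH.
Qed.

Lemma nf_ge0 r : 0 <= r -> N (i r) = r.
Proof. by move=> r0; rewrite Ni ger0_norm. Qed.

(** Square roots may be missing in [R]. The least [k] with [r <= (k/m)^2] brackets the root between
    neighbouring points of a grid of mesh [1/m]. *)
Lemma sqrt_approx (r e : R) : 0 <= r -> 0 < e ->
  exists a b : R, [/\ 0 <= a, 0 <= b, a ^+ 2 <= r, r <= b ^+ 2
    & b ^+ 2 - a ^+ 2 <= e].
Proof.
move=> r0 e0; have [n hn] := arch (2 * (r + 2) / e).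
pose m : R := n.+1%:R; have m0 : 0 < m by rewrite ltr0n.
have m1 : 1 <= m by rewrite ler1n.
have hm : 2 * (r + 2) <= m * e.
  rewrite -ler_pdivrMr//; apply: le_trans hn _.
  by rewrite ler_nat.
have ex : exists k : nat, r <= (k%:R / m) ^+ 2.
  have [k hk] := arch ((r + 1) * m); exists k.
  have : r + 1 <= k%:R / m by rewrite ler_pdivlMr.
  by set t := k%:R / m; nra.
case: (ex_minnP ex) => -[|k] hk kmin.
  exists 0, 0; rewrite expr0n /=; move: hk; rewrite mul0r expr0n /= => hk.
  by split; lra.
have lt : (k%:R / m) ^+ 2 < r by rewrite ltNge; apply/negP => /kmin; rewrite ltnn.
exists (k%:R / m), (k.+1%:R / m).
have k0 : 0 <= k%:R / m by rewrite divr_ge0// ltW.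
have E : k.+1%:R / m = k%:R / m + m^-1 by rewrite -natr1 mulrDl mul1r.
have i0 : 0 < m^-1 by rewrite invr_gt0.
have i1 : m^-1 <= 1 by rewrite invf_le1.
have hi : 2 * (r + 2) * m^-1 <= e by rewrite ler_pdivrMr// [e * m]mulrC.
split; [done|exact: divr_ge0 (ler0n _ _) (ltW m0)|exact: ltW|done|].
rewrite E; move: lt k0 i0 i1 hi; set t := k%:R / m; set u := m^-1 => lt k0 i0 i1 hi.
have tr : t <= r + 1 by nra.
nra.
Qed.

(* [A ^+ 2 <= C] says that the quadratic has no simple real root. *)
Definition quad_ge (v : K) (m : R) :=
  forall A C : R, A ^+ 2 <= C -> m <= N (v ^+ 2 + i (2 * A) * v + i C).

(* For [A ^+ 2 <= C] the quartic [v^4 + 2 A v^2 + C] factors as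
   [(v^2 + b v + c) (v^2 - b v + c)] with [c = sqrt C] and [b = sqrt (2 (c - A))]. *)
Lemma quad_ge_sqr v m : 0 <= m -> quad_ge v m -> quad_ge (v ^+ 2) (m ^+ 2).
Proof.
move=> m0 Q A C AC.
apply/ler_addgt0Pr => e e0.
have v0 := N_ge0 v; have d0 : 0 < N v ^+ 2 + 1 by nra.
pose h := e / (N v ^+ 2 + 1); have h0 : 0 < h by rewrite divr_gt0.
have hE : h * (N v ^+ 2 + 1) = e by rewrite divfK// gt_eqF.
have C0 : 0 <= C by nra.
(* The root [c] is rounded up, so that [|A| <= c]; below, [b] is rounded down, so that
   [(b/2)^2 <= c] and both quadratic factors are admissible. The rounding costs at most
   [h * N v ^+ 2 + h = e]. *)
have [c' [c [_ c0 hc' hc hcc]]] := sqrt_approx C0 h0.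
have cA : `|A| <= c by rewrite -(@ler_pXn2r _ 2)// ?nnegrE// real_normK ?num_real//; lra.
have [lA uA] : A <= c /\ - A <= c by move: cA; rewrite ler_norml => /andP[]; lra.
have r0 : 0 <= 2 * (c - A) by lra.
have [b [b' [b0 _ hb hb' hbb]]] := sqrt_approx r0 h0.
have p1 : m <= N (v ^+ 2 + i b * v + i c).
  by have := Q (b / 2) c; rewrite (_ : 2 * (b / 2) = b); [apply; nra|lra].
have p2 : m <= N (v ^+ 2 - i b * v + i c).
  by have := Q (- (b / 2)) c; rewrite (_ : 2 * - (b / 2) = - b) ?rmorphN ?mulNr; [apply; nra|lra].
have : m ^+ 2 <= N (v ^+ 2 + i b * v + i c) * N (v ^+ 2 - i b * v + i c).
  by rewrite expr2 ler_pM.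
rewrite -NM => /le_trans; apply.
have -> : (v ^+ 2 + i b * v + i c) * (v ^+ 2 - i b * v + i c) =
  ((v ^+ 2) ^+ 2 + i (2 * A) * v ^+ 2 + i C)
   + (i (2 * (c - A) - b ^+ 2) * v ^+ 2 + i (c ^+ 2 - C)).
  by rewrite !rmorphE; ring.
apply: le_trans (ND _ _) _; rewrite lerD2l.
apply: le_trans (ND _ _) _; rewrite NM nfX !nf_ge0; [|lra|lra].
rewrite -hE [h * _]mulrDr mulr1 lerD//; last lra.
by rewrite ler_wpM2r ?exprn_ge0//; lra.
Qed.

(** A real translation of the variable leaves the discriminant [A^2 - C] unchanged. *)
Lemma quad_ge_shift v m a : quad_ge v m -> quad_ge (v + i a) m.
Proof.
move=> Q A C AC.
have := Q (A + a) (a ^+ 2 + 2 * A * a + C).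
have -> : (v + i a) ^+ 2 + i (2 * A) * (v + i a) + i C =
  v ^+ 2 + i (2 * (A + a)) * v + i (a ^+ 2 + 2 * A * a + C).
  by rewrite !rmorphE; ring.
by apply; nra.
Qed.

Lemma quad_ge_linear v m a : 0 <= m -> quad_ge v (m ^+ 2) -> m <= N (v + i a).
Proof.
move=> m0 /(_ a (a ^+ 2) (lexx _)).
have -> : v ^+ 2 + i (2 * a) * v + i (a ^+ 2) = (v + i a) ^+ 2.
  by rewrite !rmorphE; ring.
by rewrite nfX ler_pXn2r// nnegrE.
Qed.

Lemma quad_ge_scale v m c : 0 < c -> quad_ge v m -> quad_ge (v * i c) (m * c ^+ 2).
Proof.
move=> c0 Q A C AC.
have hq : (A / c) ^+ 2 <= C / c ^+ 2.
  by rewrite exprMn exprVn ler_wpM2r// invr_ge0 exprn_ge0// ltW.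
have := Q _ _ hq.
have cN0 : i c != 0 by rewrite fmorph_eq0 gt_eqF.
have -> : (v * i c) ^+ 2 + i (2 * A) * (v * i c) + i C =
  (v ^+ 2 + i (2 * (A / c)) * v + i (C / c ^+ 2)) * i (c ^+ 2).
  by rewrite !rmorphE /= ?fmorphV ?rmorphE; field.
have c2 : 0 <= c ^+ 2 by rewrite exprn_ge0// ltW.
by rewrite NM nf_ge0// => h; rewrite ler_wpM2r.
Qed.

Lemma quad_ge_pow v k : quad_ge v 1 -> quad_ge (v ^+ (2 ^ k)) 1.
Proof.
move=> Q; elim: k => [|k IH]; first by rewrite expn0 expr1.
by rewrite expnSr exprM -[1](expr1n _ 2); exact: quad_ge_sqr.
Qed.

(** The right side factors as [(v - r)(v + r)(v^2 + r^2)(v^4 + r^4)...], and every factor other than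
    [v + r] has norm at least 1. *)
Lemma norm_add_le v r k : quad_ge v 1 ->
  N (v + i r) <= N (v ^+ (2 ^ k.+1) - i r ^+ (2 ^ k.+1)).
Proof.
move=> Q; have Q1 j a : 1 <= N (v ^+ (2 ^ j) + i a).
  by apply: quad_ge_linear => //; rewrite expr1n; exact: quad_ge_pow.
elim: k => [|k IH].
  rewrite subr_sqr NM ler_peMl//.
  by have := Q1 0%N (- r); rewrite expn0 expr1 rmorphN.
rewrite [in leRHS]expnSr !exprM subr_sqr NM; apply: le_trans IH _.
by rewrite ler_peMr// -rmorphXn.
Qed.

Lemma expr2n_small (e : R) : 0 < e -> exists n, (2 ^+ n)^-1 <= e.
Proof.
move=> e0; have [n hn] := arch (e^-1); exists n.
rewrite -[e]invrK lef_pV2 ?posrE ?invr_gt0 ?exprn_gt0//.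
apply: le_trans hn _; rewrite -natrX ler_nat.
by apply: ltnW; exact: ltn_expl.
Qed.

Lemma expr1D_small n (e : R) : 0 < e ->
  exists h : R, [/\ 0 < h, h <= e & (1 + h) ^+ n <= 1 + e].
Proof.
move=> e0; have p0 : 0 < 2 ^+ n :> R by rewrite exprn_gt0.
have p1 : 1 <= 2 ^+ n :> R by rewrite exprn_ege1// ler1n.
pose h := e / ((1 + e) * 2 ^+ n); exists h.
have d0 : 0 < (1 + e) * 2 ^+ n by rewrite mulr_gt0//; lra.
have h0 : 0 < h by rewrite divr_gt0.
have hE : h * ((1 + e) * 2 ^+ n) = e by rewrite divfK// gt_eqF.
have hq : h <= h * 2 ^+ n by rewrite ler_peMr// ltW.
have hE' : h * 2 ^+ n * (1 + e) = e by rewrite -[RHS]hE; ring.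
have he : h * 2 ^+ n <= e by move: hq hE'; set q := h * 2 ^+ n; nra.
have h1 : h <= 1 by move: hq hE'; set q := h * 2 ^+ n; nra.
split=> //; first exact: le_trans he.
(* A reverse Bernoulli inequality, valid because [h <= 1]. *)
suff : (1 + h) ^+ n <= 1 + (2 ^+ n - 1) * h by lra.
elim: (n) => [|k IH]; first by rewrite !expr0; lra.
have k1 : 1 <= 2 ^+ k :> R by rewrite exprn_ege1// ler1n.
rewrite !exprS; move: IH k1; set a := (1 + h) ^+ k; set q := 2 ^+ k => IH k1.
have : (1 + h) * a <= (1 + h) * (1 + (q - 1) * h) by rewrite ler_pM2l//; lra.
have : (q - 1) * h * h <= (q - 1) * h by rewrite ler_piMr// mulr_ge0//; lra.
lra.
Qed.

(** With [r = 1/2] in [norm_add_le], the power of [r] is at most [e/2] for large [k]; then [h] is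
    chosen so that the power of [N v] is at most [1 + e/2]. *)
Lemma near_min_step (e : R) : 0 < e -> exists h : R, [/\ 0 < h, h <= e &
  forall v, quad_ge v 1 -> N v <= 1 + h -> N (v + i (1 / 2)) <= 1 + e].
Proof.
move=> e0; have e2 : 0 < e / 2 by lra.
have [k hk] := expr2n_small e2.
have [h [h0 he hh]] := expr1D_small (2 ^ k.+1) e2.
exists h; split=> //; first lra.
move=> v Q vh; apply: le_trans (norm_add_le (1 / 2) k Q) _.
apply: le_trans (ND _ _) _; rewrite nfN !nfX nf_ge0 ?divr_ge0//.
have : N v ^+ (2 ^ k.+1) <= (1 + h) ^+ (2 ^ k.+1).
  by rewrite lerXn2r ?nnegrE//; lra.
suff : (1 / 2) ^+ (2 ^ k.+1) <= (2 ^+ k)^-1 :> R by lra.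
rewrite mul1r exprVn lef_pV2 ?posrE ?exprn_gt0//.
rewrite ler_weXn2l ?ler1n//.
by apply: (leq_trans (ltnW (ltn_expl k (ltnSn 1)))); rewrite leq_exp2l.
Qed.

Lemma near_min_steps n (e : R) : 0 < e -> exists h : R, [/\ 0 < h, h <= e &
  forall v, quad_ge v 1 -> N v <= 1 + h -> N (v + i (n%:R / 2)) <= 1 + e].
Proof.
elim: n e => [|n IH] e e0.
  by exists e; split=> // v _; rewrite mul0r rmorph0 addr0.
have [h1 [h10 h1e H1]] := near_min_step e0.
have [h [h0 he H]] := IH _ h10.
exists h; split=> //; first lra.
move=> v Q /(H _ Q) /(H1 _ (quad_ge_shift _ Q)).
by rewrite -addrA -rmorphD -mulrDl natr1.
Qed.

Lemma no_near_min : exists h : R, 0 < h /\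
  forall v, quad_ge v 1 -> ~ (N v <= 1 + h).
Proof.
have h2 : 0 < 1 / 2 :> R by lra.
(* Eight half-steps move [v] by 4, so [N (v + 4) >= 4 - 3/2], against the bound [3/2] from
   [near_min_steps]. *)
have [h [h0 he H]] := near_min_steps 8 h2; exists h; split=> // v Q vh.
have := H v Q vh; rewrite addrC; have := nfB (i (8 / 2)) v.
by rewrite nf_ge0; lra.
Qed.

(* The infimum of [|z^2 + 2 A z + C|] over the quadratics without simple real roots is [0]:
   at a positive near-minimum [v], [near_min_steps] would make [v + r] a near-minimum
   for arbitrarily large [r]. *)
Lemma quadratic_approx (z : K) (d : R) : 0 < d ->
  exists A C : R, A ^+ 2 <= C /\ N (z ^+ 2 + i (2 * A) * z + i C) < d.
Proof.
move=> d0; apply: contrapT => hn.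
have [h [h0 Hh]] := no_near_min.
have Q0 : quad_ge z d.
  by move=> A C AC; rewrite leNgt; apply/negP => hlt; apply: hn; exists A, C.
(* The bounds grow geometrically, so one of them exceeds [N (z^2)], the value at [A = C = 0]. Just
   before the first failing [k], the bound [M] holds while [M * (1 + h)] fails. *)
have ex : exists k, ~~ `[< quad_ge z (d * (1 + h) ^+ k) >].
  have [k hk] := arch (N (z ^+ 2) / (d * h)); exists k; apply/asboolPn => Q.
  have z2 : z ^+ 2 + i (2 * 0) * z + i 0 = z ^+ 2.
    by rewrite mulr0 rmorph0 mul0r !addr0.
  have := Q 0 0; rewrite z2 expr0n => /(_ (lexx _)).
  apply/negP; rewrite -ltNge.
  have : 1 + k%:R * h <= (1 + h) ^+ k.
    elim: (k) => [|l IH]; first by rewrite mul0r expr0; lra.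
    have l0 : 0 <= l%:R :> R by [].
    rewrite exprS -natr1; move: IH l0; set a := (1 + h) ^+ l; set q := l%:R => IH l0.
    have : (1 + h) * (1 + q * h) <= (1 + h) * a by rewrite ler_pM2l//; lra.
    nra.
  have : N (z ^+ 2) <= k%:R * (d * h) by rewrite -ler_pdivrMr// mulr_gt0.
  by move: k%:R ((1 + h) ^+ k) => q a; nra.
case: (ex_minnP ex) => -[|k] /asboolPn hk kmin.
  by apply: hk; rewrite expr0 mulr1.
have Qk : quad_ge z (d * (1 + h) ^+ k).
  by apply/asboolP; rewrite -[X in is_true X]negbK; apply/negP => /kmin; rewrite ltnn.
move: Qk hk; rewrite exprS; set a := (1 + h) ^+ k => Qk hk.
have a0 : 0 < a by rewrite exprn_gt0//; lra.
pose M := d * a; have M0 : 0 < M by rewrite mulr_gt0.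
apply: hk => A C AC; rewrite leNgt; apply/negP => hlt.
set v := z ^+ 2 + _ + _ in hlt.
(* Completing the square writes [v] as a translate of the square of a translate of [z]; dividing [v]
   by [M] then normalises the bound to 1. *)
have Qv : quad_ge v (M ^+ 2).
  have -> : v = (z + i A) ^+ 2 + i (C - A ^+ 2) by rewrite /v !rmorphE; ring.
  by apply/quad_ge_shift/quad_ge_sqr/quad_ge_shift => //; exact: ltW.
have iM : 0 < M^-1 by rewrite invr_gt0.
have := quad_ge_scale iM Qv; rewrite exprVn mulfV ?gt_eqF ?exprn_gt0// => Q1.
apply: (Hh _ Q1); rewrite NM nf_ge0 ?(ltW iM)// ler_pdivrMr// /M; lra.
Qed.

(** The triangle inequality gives [A^2 <= C <= 2|A| + 2]. *)
Lemma real_quadratic_bounds (a : K) (A C : R) :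
  N a <= 1 -> A ^+ 2 <= C -> N (a ^+ 2 + i (2 * A) * a + i C) <= 1 ->
  `|A| <= 3 /\ C - A ^+ 2 <= 9.
Proof.
move=> a1 AC h.
have C0 : 0 <= C by nra.
have := nfB (i C) (a ^+ 2 + i (2 * A) * a); rewrite [i C + _]addrC nf_ge0// => h1.
have := ND (a ^+ 2) (i (2 * A) * a).
rewrite nfX NM Ni normrM (ger0_norm (ler0n _ 2)) => h2.
have hC : C <= 2 * `|A| + 2.
  have : 2 * `|A| * N a <= 2 * `|A| by rewrite ler_piMr// mulr_ge0.
  have : N a ^+ 2 <= 1 by rewrite exprn_ile1.
  lra.
have AE : `|A| ^+ 2 = A ^+ 2 by rewrite real_normK ?num_real.
by move: (normr_ge0 A) AE hC; set t := `|A| => t0 AE hC; split; nra.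
Qed.

(* A two-dimensional real subspace comes within [1/2] of every point of the unit ball,
   an approximate form of the Gelfand-Mazur-Ostrowski theorem that needs no completeness. *)
Lemma unit_ball_decomposition : exists j : K, forall a, N a <= 1 ->
  exists (s t : R) (a' : K),
    [/\ `|s| <= 3, `|t| <= 3, N a' <= 1 & a = i s + j * i t + i (1 / 2) * a'].
Proof.
have half x : N x <= 1 / 2 -> exists2 a', N a' <= 1 & x = i (1 / 2) * a'.
  move=> hx; exists (i 2 * x); first by rewrite NM nf_ge0//; lra.
  by rewrite mulrA -rmorphM (_ : 1 / 2 * 2 = 1) ?rmorph1 ?mul1r//; lra.
have [h|] := pselect (forall a, N a <= 1 -> exists s : R, N (a - i s) <= 1 / 2).
  exists 0 => a a1; have [s hs] := h a a1.
  have [a' ha' E] := half _ hs; exists s, 0, a'; split=> //; last first.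
  - by rewrite mul0r addr0 -E addrC subrK.
  - by rewrite normr0.
  - have := nfB (- i s) a; rewrite nfN Ni [- i s + a]addrC; lra.
(* From here on, [z] is at distance more than [1/2] from the real line. *)
move=> /existsNP[z /not_implyP[_ hz]].
have hz1 s : 1 / 2 < N (z + i s).
  rewrite ltNge; apply/negP => hs; apply: hz; exists (- s).
  by rewrite rmorphN opprK.
have d0 : 0 < 1 / 1280 :> R by lra.
have [A [C [AC hAC]]] := quadratic_approx z d0.
have r0 : 0 <= C - A ^+ 2 by lra.
have [b1 [b [_ b0 hb1 hb hbb]]] := sqrt_approx r0 d0.
set u := z + i A.
have uE : z ^+ 2 + i (2 * A) * z + i C = u ^+ 2 + i (C - A ^+ 2).
  by rewrite /u !rmorphE; ring.
rewrite uE in hAC.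
have rb : 1 / 8 <= b ^+ 2.
  have := nfB (u ^+ 2) (i (C - A ^+ 2)); rewrite nfX nf_ge0//.
  have := hz1 A; rewrite -/u; move: (N u) => n; nra.
have bp : 0 < b by nra.
have ib : i b != 0 by rewrite fmorph_eq0 gt_eqF.
(* Since [u^2] is nearly [-b^2], [j] is an approximate square root of [-1]. The error is at most
   [(2/1280) / (1/8) = 1/80]. *)
pose j := u / i b; exists j.
have jE : N (j ^+ 2 + 1) <= 1 / 80.
  have -> : j ^+ 2 + 1 = i ((b ^+ 2)^-1) * ((u ^+ 2 + i (C - A ^+ 2)) + i (b ^+ 2 - (C - A ^+ 2))).
    by rewrite /j fmorphV !rmorphE; field.
  rewrite NM nf_ge0 ?invr_ge0 ?exprn_ge0// mulrC ler_pdivrMr ?exprn_gt0//.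
  apply: le_trans (ND _ _) _.
  rewrite [N (i _)]nf_ge0; lra.
move=> a a1.
have e0 : 0 < 1 / 16 :> R by lra.
have [A' [C' [AC' hAC']]] := quadratic_approx a e0.
have [bA bC] : `|A'| <= 3 /\ C' - A' ^+ 2 <= 9.
  by apply: real_quadratic_bounds a1 AC' _; lra.
have r0' : 0 <= C' - A' ^+ 2 by lra.
have [t [t1 [t0 _ ht ht1 htt]]] := sqrt_approx r0' e0.
have t3 : t <= 3 by nra.
have E : a ^+ 2 + i (2 * A') * a + i C' + (i (t ^+ 2 - (C' - A' ^+ 2)) - i (t ^+ 2) * (j ^+ 2 + 1))
   = (a + i A' - j * i t) * (a + i A' + j * i t).
  by rewrite !rmorphE; ring.
(* The errors sum to at most [1/16 + 1/16 + 9/80 < 1/4], so one of the two factors has norm at most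
   [1/2]. *)
have hprod : N (a + i A' - j * i t) * N (a + i A' + j * i t) <= 1 / 4.
  rewrite -NM -E; apply: le_trans (ND _ _) _.
  have := ND (i (t ^+ 2 - (C' - A' ^+ 2))) (- (i (t ^+ 2) * (j ^+ 2 + 1))).
  rewrite nfN NM [N (i (t ^+ 2))]nf_ge0 ?exprn_ge0// Ni ler0_norm; last lra.
  have : t ^+ 2 * N (j ^+ 2 + 1) <= 9 * (1 / 80) by rewrite ler_pM// ?exprn_ge0//; lra.
  lra.
have tn : `|t| <= 3 by rewrite ger0_norm.
have [hm|hm] := lerP (N (a + i A' - j * i t)) (1 / 2).
  have [a' ha' Ea] := half _ hm; exists (- A'), t, a'; rewrite normrN; split=> //.
  by rewrite -Ea rmorphN; ring.
have [hp|hp] := lerP (N (a + i A' + j * i t)) (1 / 2).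
  have [a' ha' Ea] := half _ hp; exists (- A'), (- t), a'; rewrite !normrN; split=> //.
  by rewrite -Ea !rmorphN; ring.
by exfalso; move: hprod hm hp; move: (N _) (N _) => n1 n2; nra.
Qed.

End ArchimedeanNormedField.

Lemma numField_unit_ball (K : numFieldType) :
  (forall x : realpart K, exists n : nat, x <= n%:R) ->
  exists j : K, forall a, `|a| <= 1 -> exists s t a' : K,
    [/\ s \is Num.real, t \is Num.real, `|s| <= 3%:R /\ `|t| <= 3%:R, `|a'| <= 1 &
        a = s + j * t + 2%:R^-1 * a'].
Proof.
move=> arch; pose N (x : K) : realpart K := RealPart (normr_real x).
have [||||j H] := @unit_ball_decomposition _ K (val : {rmorphism realpart K -> K}) N arch.
- by move=> x; exact: normr_ge0.
- by move=> x y; exact: ler_normD.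
- by move=> x y; apply: val_inj; rewrite /= normrM.
- by move=> r; apply: val_inj.
exists j => a a1; have [s [t [a' [hs ht ha' ->]]]] := H a a1.
exists (val s), (val t), a'; split; [exact: rvalP|exact: rvalP|split|exact: ha'|].
- by move: hs; rewrite rval_le rmorph_nat.
- by move: ht; rewrite rval_le rmorph_nat.
- by rewrite div1r fmorphV rmorph_nat.
Qed.

(** * Bounded multipliers on finite sums *)

Section BoundedMultipliers.
Variables (K : numFieldType) (X : lmodType K).

Definition cvx_bal (W : set X) :=
  (forall u v t, W u -> W v -> 0 <= t <= 1 -> W (t *: u + (1 - t) *: v)) /\
  (forall u (a : K), W u -> `|a| <= 1 -> W (a *: u)).

Variable W : set X.
Hypothesis cbW : cvx_bal W.

(** Plays the part of the bound [c] on the gauge of [W], without taking infima in [K]. *)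
Definition dil (c : K) (z : X) := exists2 u, W u & z = c *: u.

Lemma dil_add c d z z' : 0 <= c -> 0 <= d -> dil c z -> dil d z' -> dil (c + d) (z + z').
Proof.
move=> c0 d0 [u Wu ->] [u' Wu' ->].
have [cd0|cd0] := eqVneq (c + d) 0.
  move: cd0 => /eqP; rewrite paddr_eq0// => /andP[/eqP-> /eqP->].
  by exists u => //; rewrite addr0 !scale0r addr0.
have p : 0 < c + d by rewrite lt_def cd0 addr_ge0.
exists ((c / (c + d)) *: u + (1 - c / (c + d)) *: u').
  apply: cbW.1 => //; rewrite divr_ge0 ?(ltW p)//= ler_pdivrMr// mul1r.
  by rewrite lerDl.
rewrite scalerDr !scalerA mulrBr mulr1 mulrC divfK//.
by rewrite [c + d]addrC addrK.
Qed.

Lemma dil_le c d z : 0 <= c -> c <= d -> dil c z -> dil d z.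
Proof.
move=> c0 cd [u Wu ->]; have d0 := le_trans c0 cd.
have [dz|dz] := eqVneq d 0.
  by exists u => //; move: c0 cd; rewrite dz => h1 h2; congr (_ *: _); apply/le_anti/andP.
exists ((c / d) *: u); last by rewrite scalerA mulrC divfK.
have dp : 0 < d by rewrite lt_def dz.
by apply: cbW.2 => //; rewrite ger0_norm ?divr_ge0// ler_pdivrMr// mul1r.
Qed.

Lemma dil_scale a c z : dil c z -> dil (`|a| * c) (a *: z).
Proof.
move=> [u Wu ->]; have [->|a0] := eqVneq a 0.
  by exists u => //; rewrite normr0 mul0r !scale0r.
exists ((a / `|a|) *: u).
  by apply: cbW.2 => //; rewrite normrM normfV normr_id divff// normr_eq0.
rewrite !scalerA; congr (_ *: _).
by field; rewrite normr_eq0.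
Qed.

Lemma dil_sum (T : Type) (G : seq T) (z : T -> X) : W 0 ->
  (forall n, W (z n)) -> dil (size G)%:R (\sum_(n <- G) z n).
Proof.
move=> W0 Wz; elim: G => [|n G IH].
  by rewrite big_nil; exists 0 => //; rewrite scaler0.
rewrite big_cons /= -addn1 natrD addrC; apply: dil_add => //.
by exists (z n) => //; rewrite scale1r.
Qed.

(** A point of the cube [[0,1]^G] is a convex combination of vertices, and the vertices are the
    subsums. The offset [u0] collects the terms already chosen. *)
Lemma convex_comb_subsums (T : eqType) (G : seq T) (v : T -> X) (t : T -> K) u0 :
  (forall H, subseq H G -> W (u0 + \sum_(n <- H) v n)) ->
  (forall n, 0 <= t n <= 1) -> W (u0 + \sum_(n <- G) t n *: v n).
Proof.
move=> + ht; elim: G u0 => [|n G IH] u0 H.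
  by have := H [::] isT; rewrite !big_nil.
rewrite big_cons.
have h1 : W (u0 + v n + \sum_(n <- G) t n *: v n).
  apply: IH => H' sH; have := H (n :: H'); rewrite /= eqxx big_cons addrA.
  exact.
have h2 : W (u0 + \sum_(n <- G) t n *: v n).
  by apply: IH => H' sH; apply: H; apply: subseq_trans sH (subseq_cons _ _).
have := cbW.1 _ _ _ h1 h2 (ht n).
rewrite [u0 + v n + _]addrAC (scalerDr (t n) (u0 + _)) addrAC -scalerDl.
by rewrite [t n + _]addrC subrK scale1r addrAC -addrA.
Qed.

Lemma real_multipliers (T : eqType) (G : seq T) (v : T -> X) (s : T -> K) :
  (forall H, subseq H G -> W (\sum_(n <- H) v n)) ->
  (forall n, s n \is Num.real /\ `|s n| <= 3%:R) ->
  dil 6%:R (\sum_(n <- G) s n *: v n).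
Proof.
move=> HG hs.
have six : 0 < 6%:R :> K by rewrite ltr0n.
have hv (e : K) : e = 1 \/ e = -1 ->
  W (\sum_(n <- G) ((`|s n| + e * s n) / 6%:R) *: v n).
  move=> he; rewrite -[X in W X]add0r; apply: convex_comb_subsums.
    by move=> H sH; rewrite add0r; exact: HG.
  move=> n; have [rs bs] := hs n.
  have er : e * s n \is Num.real by case: he => ->; rewrite ?mul1r ?mulN1r ?rpredN.
  have ne : `|e * s n| = `|s n| by case: he => ->; rewrite ?mul1r ?mulN1r ?normrN.
  have := real_ler_norml `|s n| er; rewrite ne lexx => /esym/andP[h1 h2].
  rewrite divr_ge0 ?ler0n//=; last by rewrite -lerBlDl sub0r.
  rewrite ler_pdivrMr// mul1r.
  apply: le_trans (lerD (lexx _) h2) _.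
  by apply: le_trans (lerD bs bs) _; rewrite -natrD.
rewrite (_ : 6%:R = 3%:R + 3%:R); last by rewrite -natrD.
(* Splitting into positive and negative parts and dividing by 3 puts all coefficients in [[0,1]]. *)
have -> : \sum_(n <- G) s n *: v n =
   3%:R *: (\sum_(n <- G) ((`|s n| + 1 * s n) / 6%:R) *: v n)
   + (- 3%:R) *: \sum_(n <- G) ((`|s n| + (-1) * s n) / 6%:R) *: v n.
  rewrite !scaler_sumr -big_split /=; apply: eq_bigr => n _.
  by rewrite !scalerA -scalerDl; congr (_ *: _); field.
apply: dil_add; rewrite ?ler0n//.
  by eexists; [apply: hv; left|].
rewrite -[X in dil X _]mulr1 -[X in dil (X * _) _](@ger0_norm _ 3%:R) ?ler0n// -normrN.
by apply: dil_scale; eexists; [apply: hv; right|rewrite scale1r].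
Qed.

End BoundedMultipliers.

(** The point is that [c] depends on [K] alone, in particular not on the length of [G]. *)
Lemma bounded_multipliers (K : numFieldType) : exists2 c : K, 0 < c &
  forall (X : lmodType K) (W : set X), cvx_bal W ->
  forall (T : eqType) (G : seq T) (v : T -> X) (a : T -> K),
    (forall H, subseq H G -> W (\sum_(n <- H) v n)) ->
    (forall n, `|a n| <= 1) -> dil W c (\sum_(n <- G) a n *: v n).
Proof.
have naive (X : lmodType K) (W : set X) (T : eqType) (G : seq T) (v : T -> X) (a : T -> K) :
    cvx_bal W -> (forall H, subseq H G -> W (\sum_(n <- H) v n)) ->
    (forall n, `|a n| <= 1) -> dil W (size G)%:R (\sum_(n <- G) a n *: v n).
  move=> cb HG ha.
  have W0 : W 0 by have := HG [::] (sub0seq _); rewrite big_nil.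
  (* The subsum hypothesis controls [v n] only for [n] in [G], whereas [dil_sum] asks for all
     indices. *)
  have -> : \sum_(n <- G) a n *: v n = \sum_(n <- G) (if n \in G then a n *: v n else 0).
    by apply: eq_big_seq => n ->.
  apply: (dil_sum cb) => // n; case: ifPn => // nG.
  apply: cb.2 => //; have := HG [:: n]; rewrite sub1seq big_seq1; exact.
(* In the non-archimedean case a scalar above every natural number bounds every length. *)
have [arch|] := pselect (forall x : realpart K, exists n : nat, x <= n%:R); last first.
  move=> /existsNP[x /forallNP hx].
  have hxn n : n%:R <= val x.
    have : (n%:R : realpart K) <= x by rewrite leNgt; apply/negP => /ltW; exact: hx.
    by move=> h; have : val (n%:R : realpart K) <= val x := h; rewrite rmorph_nat.
  exists (val x).
    by apply: lt_le_trans (hxn 1%N); rewrite ltr01.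
  move=> X W cb T G v a HG ha.
  by apply: (dil_le cb) (hxn (size G)) _ => //; exact: naive.
have [j Hj] := numField_unit_ball arch.
(* [L] bounds the contribution of [s + j t]. Iterating the decomposition halves the remainder each
   time, for a total of [L (1 + 1/2 + 1/4 + ...) <= 2 L]. *)
pose L : K := 6%:R + `|j| * 6%:R.
have L0 : 0 <= L by rewrite addr_ge0 ?mulr_ge0 ?ler0n.
have c0 : 0 < 2%:R * L + 1 by rewrite ltr_wpDl// mulr_ge0.
exists (2%:R * L + 1) => // X W cb T G v a HG ha.
have iter k (b : T -> K) : (forall n, `|b n| <= 1) ->
    dil W (2%:R * L + (2%:R ^+ k)^-1 * (size G)%:R) (\sum_(n <- G) b n *: v n).
  elim: k b => [|k IH] b hb.
    rewrite expr0 invr1 mul1r; apply: (dil_le cb) (naive _ _ _ _ _ _ cb HG hb) => //.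
    by rewrite lerDr mulr_ge0.
  have [s Hs] := choice (fun n => Hj (b n) (hb n)).
  have [t Ht] := choice Hs.
  have [b' Hb'] := choice Ht.
  have -> : \sum_(n <- G) b n *: v n = (\sum_(n <- G) s n *: v n
      + j *: \sum_(n <- G) t n *: v n) + 2%:R^-1 *: \sum_(n <- G) b' n *: v n.
    rewrite !scaler_sumr -!big_split /=; apply: eq_bigr => n _.
    have [_ _ _ _ {1}->] := Hb' n; by rewrite !scalerDl !scalerA.
  have -> : 2%:R * L + (2%:R ^+ k.+1)^-1 * (size G)%:R =
     L + `|2%:R^-1 : K| * (2%:R * L + (2%:R ^+ k)^-1 * (size G)%:R).
    rewrite ger0_norm ?invr_ge0 ?ler0n// exprS.
    have : (2%:R : K) ^+ k != 0 by rewrite expf_neq0// pnatr_eq0.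
    by move: (2%:R ^+ k) (size G)%:R => p q p0; field.
  apply: (dil_add cb) => //; last first.
  - by apply: (dil_scale cb); apply: IH => n; have [] := Hb' n.
  - apply: (dil_add cb); rewrite ?mulr_ge0 ?ler0n//.
      by apply: (real_multipliers cb HG) => n; have [? ? [? ?]] := Hb' n.
    apply: (dil_scale cb).
    by apply: (real_multipliers cb HG) => n; have [? ? [? ?]] := Hb' n.
  - by rewrite mulr_ge0// addr_ge0// mulr_ge0// ?invr_ge0 ?exprn_ge0// ler0n.
(* After this many iterations the leftover [size G / 2^k] is at most 1. *)
have [k hk] := arch (size G)%:R.
apply: (dil_le cb) (iter k a ha).
  by rewrite addr_ge0 ?mulr_ge0 ?invr_ge0 ?exprn_ge0 ?ler0n.
rewrite lerD2l mulrC ler_pdivrMr ?exprn_gt0 ?ltr0n// mul1r -natrX ler_nat.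
have : val ((size G)%:R : realpart K) <= val (k%:R : realpart K) := hk.
rewrite !rmorph_nat ler_nat => /leq_trans; apply.
by apply: ltnW; exact: ltn_expl.
Qed.

(** * Baire category in complete uniform spaces with a countable base *)

Lemma small_nbhs (T : uniformType) (x : T) (A : set (T * T)) : entourage A ->
  exists2 M, nbhs x M & forall y z, M y -> M z -> A (y, z).
Proof.
move=> entA; have entB := entourage_split_ent entA.
exists (xsection (split_ent A) x `&` xsection ((split_ent A)^-1)%relation x).
  apply: filterI; apply: nbhs_entourage => //; exact: entourage_inv.
move=> y z [_ /xsectionP h1] [/xsectionP h2 _].
exact: (entourage_split x entA).
Qed.

Lemma complete_uniform_baire (T : uniformType) (x0 : T) (O : nat -> set T) :
  countable_uniformity T ->
  (forall F : set_system T, ProperFilter F -> cauchy F -> exists l : T, F --> l) ->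
  (forall n, open (O n)) -> (forall n, dense (O n)) -> exists x, forall n, O n x.
Proof.
move=> /countable_uniformityP[f fbase fent] cplt Oo Od.
(* Shrinks a set with interior to one whose closure lies in it and in [O k], and which is small for
   the entourage [f k]. The premise sits under the existential so that [choice] yields a total
   function to iterate. *)
have step (kN : nat * set T) : exists N' : set T, kN.2° !=set0 ->
    [/\ N'° !=set0, closure N' `<=` kN.2 `&` O kN.1
      & forall x y, N' x -> N' y -> f kN.1 (x, y)].
  case: kN => k N /=.
  have [ne|ne] := pselect (N° !=set0); last by exists set0.
  have [x [Nx Ox]] := Od k _ ne (open_interior N).
  have nx : nbhs x (N `&` O k) by apply: filterI => //; exact: open_nbhs_nbhs.
  have [V Vx VN] := uniform_regular nx.
  have [M Mx fM] := small_nbhs x (fent k).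
  exists (V `&` M) => _; split.
  - by exists x; exact: filterI.
  - by apply: subset_trans VN; apply: closure_subset => y [].
  - by move=> y z [_ My] [_ Mz]; exact: fM.
have [g hg] := choice step.
pose Ns := fix Ns n := if n is k.+1 then g (k, Ns k) else setT.
have Nne n : (Ns n)° !=set0.
  elim: n => [|n IH]; first by exists x0; rewrite /= interiorT.
  by have [] := hg (n, Ns n) IH.
have Ncl n : closure (Ns n.+1) `<=` Ns n `&` O n by have [] := hg (n, Ns n) (Nne n).
have Nf n x y : Ns n.+1 x -> Ns n.+1 y -> f n (x, y).
  by have [_ _] := hg (n, Ns n) (Nne n); exact.
have Nmono k n : (k <= n)%N -> Ns n `<=` Ns k.
  elim: n => [|n IH]; first by rewrite leqn0 => /eqP->.
  rewrite leq_eqVlt => /orP[/eqP->//|]; rewrite ltnS => /IH; apply: subset_trans.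
  by move=> y /subset_closure /Ncl [].
have Npt n : exists x, Ns n x by have [x /interior_subset] := Nne n; exists x.
have [x hx] := choice Npt.
have xN k : \forall n \near \oo, Ns k (x n).
  by near=> n; apply: (Nmono k n); [near: n; exact: nbhs_infty_ge|exact: hx].
have cx : cauchy (x @ \oo).
  move=> A /fbase [k fA]; exists (Ns k.+1, Ns k.+1).
    by split; exact: (xN k.+1).
  by move=> [y z] [Ny Nz]; apply: fA; exact: Nf.
have [l xl] := cplt _ _ cx.
exists l => n; suff /Ncl[] : closure (Ns n.+1) l by [].
move=> B /xl Bx.
have [m [Bm Nm]] := @filter_ex _ _ _ _ (filterI Bx (xN n.+1)).
by exists m.
Unshelve. all: by end_near. Qed.

(** * Neighbourhoods of zero, completeness and equicontinuity in topological vector spaces *)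

Section Tvs.
Variables (K : numFieldType) (X : tvsType K).

Lemma nbhs_addr (a u : X) V : nbhs (a + u) V -> nbhs a [set z | V (z + u)].
Proof.
move=> /(add_continuous (a, u)) [[B1 B2] /= [h1 h2] sub].
by apply: filterS h1 => z Bz; apply: (sub (z, u)); split=> //; exact: nbhs_singleton.
Qed.

Lemma nbhs0_addr (u : X) V : nbhs u V -> nbhs 0 [set z | V (z + u)].
Proof. by move=> h; apply: nbhs_addr; rewrite add0r. Qed.

Lemma nbhs_subr (u : X) V : nbhs 0 V -> nbhs u [set z | V (z - u)].
Proof. by move=> h; apply: nbhs_addr; rewrite subrr. Qed.

Lemma nbhs0_split (U : set X) : nbhs 0 U ->
  exists2 V, nbhs 0 V & forall x y, V x -> V y -> U (x + y).
Proof.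
move=> hU; have := @add_continuous X (0, 0) U; rewrite /= addr0 => /(_ hU).
move=> [[B1 B2] /= [h1 h2] sub]; exists (B1 `&` B2); first exact: filterI.
by move=> x y [? _] [_ ?]; exact: (sub (x, y)).
Qed.

Lemma nbhs0_scale (c : K) (U : set X) : nbhs 0 U -> nbhs 0 [set u | U (c *: u)].
Proof.
move=> hU; have := @scale_continuous K X (c, 0) U; rewrite /= scaler0 => /(_ hU).
move=> [[B1 B2] /= [h1 h2] sub]; apply: filterS h2 => u Bu.
by apply: (sub (c, u)); split=> //=; exact: nbhs_singleton.
Qed.

Lemma nbhs0_splitB (U : set X) : nbhs 0 U ->
  exists2 V, nbhs 0 V & forall x y, V x -> V y -> U (x - y).
Proof.
move=> /nbhs0_split[V hV VU]; have hN := nbhs0_scale (-1) hV.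
exists (V `&` [set u | V (-1 *: u)]); first exact: filterI.
by move=> x y [Vx _] [_ Vy]; apply: VU => //; rewrite -scaleN1r.
Qed.

Lemma nbhs0_cvx_bal (U : set X) : nbhs 0 U ->
  exists W, [/\ nbhs 0 W, cvx_bal W & W `<=` U].
Proof.
move=> hU; have [B Bcvx [Bo Bb]] := @locally_convex K X.
have [V [BV V0] VU] := Bb 0 U hU.
have cV : forall u v (t : K), V u -> V v -> 0 <= t <= 1 -> V (t *: u + (1 - t) *: v).
  move=> u v t Vu Vv /andP[t0 t1].
  have := Bcvx V (mem_set BV) u v (Itv01 t0 t1) (mem_set Vu) (mem_set Vv).
  by rewrite inE.
have nV : nbhs 0 V by apply: open_nbhs_nbhs; split=> //; exact: Bo.
(* The balanced core of a convex neighbourhood; it contains a neighbourhood of 0 by joint continuity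
   of scaling at [(0, 0)]. *)
exists [set u | forall a : K, `|a| <= 1 -> V (a *: u)]; split.
- have := @scale_continuous K X (0, 0) V; rewrite /= scaler0 => /(_ nV).
  move=> [[B1 B2] /= [h1 h2] sub].
  have /nbhs_ballP[d /= d0 hd] := h1.
  have d2 : 0 < d / 2%:R by rewrite divr_gt0.
  have := nbhs0_scale (d / 2%:R)^-1 h2; apply: filterS => u /= Bu a a1.
  have -> : a *: u = (a * (d / 2%:R)) *: ((d / 2%:R)^-1 *: u).
    by rewrite scalerA mulfK// gt_eqF.
  apply: (sub (_, _)); split=> //=; apply: hd.
  rewrite -ball_normE /= sub0r normrN normrM (gtr0_norm d2).
  apply: (@le_lt_trans _ _ (1 * (d / 2%:R))); first by rewrite ler_wpM2r// ltW.
  by rewrite mul1r ltr_pdivrMr// ltr_pMr// ltr1n.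
- split=> [u v t hu hv ht a a1 | u b hu b1 a a1].
    rewrite scalerDr !scalerA ![a * _]mulrC -!scalerA.
    by apply: cV => //; [exact: hu|exact: hv].
  by rewrite scalerA; apply: hu; rewrite normrM mulr_ile1.
- move=> u /(_ 1); rewrite normr1 scale1r => /(_ (lexx _)); exact: VU.
Qed.

(* The uniformity of a [tvsType] need not be translation invariant, so completeness
   says nothing directly about sequences that are Cauchy for the additive structure.
   As in Klee's theorem, a Baire argument produces a translate [u + s] which is Cauchy
   for the given uniformity. *)
Lemma frechet_additive_cauchy_cvg (s : nat -> X) : frechet X ->
  (forall U : set X, nbhs 0 U -> exists n0 : nat, forall n m : nat,
     (n0 <= n)%N -> (n0 <= m)%N -> U (s n - s m)) ->
  exists l : X, s @ \oo --> l.
Proof.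
move=> [_ cu cplt] sc.
have /countable_uniformityP[f fbase fent] := cu.
(* Translations [u] for which a tail of [u + s] is small for [f k]; thickening by [N] makes [G k]
   open. *)
pose G k := [set u : X | exists (N : set X) (n0 : nat), nbhs 0 N /\ forall (n n' : nat) h h',
  (n0 <= n)%N -> (n0 <= n')%N -> N h -> N h' -> f k (u + s n + h, u + s n' + h')].
have Gopen k : open (G k).
  rewrite openE => u [N [n0 [hN HN]]].
  have [V hV VN] := nbhs0_split hN.
  apply: filterS (nbhs_subr u hV) => w /= Vw.
  exists V, n0; split=> // n n' h h' hn hn' Vh Vh'.
  have E m g : w + s m + g = u + s m + ((w - u) + g).
    by rewrite [RHS]addrACA [u + (w - u)]addrC subrK addrA.
  by rewrite !E; apply: HN => //; exact: VN.
have Gdense k : dense (G k).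
  move=> U [u0 Uu0] Uo.
  have hN : nbhs 0 [set z | U (z + u0)].
    by apply: nbhs0_addr; exact: open_nbhs_nbhs.
  have [m hm] := sc _ hN.
  have [M hM fM] := small_nbhs (u0 + s m) (fent k).
  have [V hV VM] := nbhs0_split (nbhs0_addr hM).
  have [n1 hn1] := sc _ hV.
  pose n2 := maxn m n1.
  (* This point is in [U] by the choice of [m], and it moves the tail of [s] close to [u0 + s m],
     where [M] is small for [f k]. *)
  exists (s m - s n2 + u0); split.
    by apply: hm => //; rewrite leq_maxl.
  exists V, n1; split=> // n n' h h' hn hn' Vh Vh'.
  have E j g : s m - s n2 + u0 + s j + g = (s j - s n2 + g) + (u0 + s m).
    rewrite [RHS]addrAC; congr (_ + _); rewrite [RHS]addrACA [RHS]addrC.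
    by rewrite [- s n2 + _]addrC [s j + u0]addrC addrA.
  rewrite !E; apply: fM; apply: VM => //; apply: hn1 => //; exact: leq_maxr.
have [u hu] := @complete_uniform_baire X 0 G cu cplt Gopen Gdense.
have cs : cauchy ((fun n => u + s n) @ \oo).
  move=> A /fbase [k fA]; have [N [n0 [hN HN]]] := hu k.
  pose P := [set z | exists2 n, (n0 <= n)%N & z = u + s n].
  have FP : \forall n \near \oo, P (u + s n).
    by near=> n; exists n => //; near: n; exact: nbhs_infty_ge.
  exists (P, P) => //= -[y z] /= [[n hn ->] [n' hn' ->]]; apply: fA.
  have := HN n n' 0 0 hn hn' (nbhs_singleton hN) (nbhs_singleton hN).
  by rewrite !addr0.
have [l hl] := cplt _ _ cs.
exists (l - u) => V hV.
have h : \forall n \near \oo, V (u + s n - u) := hl _ (nbhs_addr hV).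
by apply: (filterS _ h) => n /=; rewrite addrAC subrr add0r.
Unshelve. all: by end_near. Qed.

(** Uniform boundedness: the closed sets [C N] cover [X], so by Baire one of them has interior;
    subtracting an interior point moves the estimate to 0. *)
Lemma frechet_equicontinuous (P : int -> X -> X) : frechet X ->
  (forall q u v, P q (u + v) = P q u + P q v) -> (forall q, continuous (P q)) ->
  (forall u (W : set X), nbhs 0 W -> exists N : nat, forall q, (N <= `|q|)%N -> W (P q u)) ->
  forall W : set X, nbhs 0 W -> exists N : nat, exists2 U : set X, nbhs 0 U &
    forall u q, U u -> (N <= `|q|)%N -> W (P q u).
Proof.
move=> [_ cu cplt] Padd Pcont P0 W hW.
have [W1 hW1 W1W] := nbhs0_splitB hW.
have [W2 hW2 W21] := uniform_regular hW1.
pose C N := [set u | forall q : int, (N <= `|q|)%N -> closure W2 (P q u)].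
have [[N [u0 hu0]]|nC] := pselect (exists (N : nat) (u0 : X), nbhs u0 (C N)).
  exists N, [set z | C N (z + u0)]; first exact: (nbhs0_addr hu0).
  move=> u q Cu Nq; have := W1W _ _ (W21 _ (Cu q Nq)) (W21 _ (nbhs_singleton hu0 q Nq)).
  by rewrite Padd addrK.
have Copen N : open (~` C N).
  rewrite openC; have -> : C N = \bigcap_(q in [set q : int | (N <= `|q|)%N]) (P q @^-1` closure W2).
    by apply/seteqP; split=> u h q; exact: h.
  apply: closed_bigI => q _; apply: closed_comp; last exact: closed_closure.
  by move=> ? _; exact: Pcont.
have Cdense N : dense (~` C N).
  move=> U [u Uu] Uo; apply: contrapT => hn; apply: nC; exists N, u.
  have := open_nbhs_nbhs (conj Uo Uu); apply: filterS => v Uv.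
  by apply: contrapT => Cv; apply: hn; exists v.
have [u hu] := @complete_uniform_baire X 0 _ cu cplt Copen Cdense.
have [N hN] := P0 u _ hW2.
by exfalso; apply: (hu N) => q Nq; apply: subset_closure; exact: hN.
Qed.

Lemma uncond_sum_tail (c : int -> K) (e : int -> X) (x : X) : uncond_sum c e x ->
  forall W : set X, nbhs 0 W -> exists N : nat, forall G : seq int, uniq G ->
    (forall n, n \in G -> (N <= `|n|)%N) -> W (\sum_(n <- G) c n *: e n).
Proof.
move=> sx W hW; have [W1 hW1 W1W] := nbhs0_splitB hW.
have [F0 HF] := sx _ (nbhs_subr x hW1).
(* This bound makes [G] disjoint from [F0]; the sum over [G] is then the difference of two partial
   sums that both contain [F0]. *)
exists (\max_(n <- F0) `|n|%N).+1 => G uG hG.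
have dis : uniq (undup F0 ++ G).
  rewrite cat_uniq undup_uniq uG andbT /=; apply/hasPn => n /hG.
  apply: contraL; rewrite mem_undup -ltnNge ltnS => nF.
  by rewrite (big_rem n)//= leq_maxl.
have h1 := HF _ dis; have h2 := HF _ (undup_uniq F0).
have := W1W _ _ (h1 _) (h2 _); rewrite big_cat /= opprB addrA subrK addrC addKr.
by apply=> n; rewrite ?mem_cat mem_undup => ->.
Qed.

End Tvs.

(** * Products of consecutive weights *)

Section WeightProducts.
Variables (K : numFieldType) (w : int -> K).
Hypothesis w0 : forall n, w n != 0.

(** Indexing by start and length lets blocks be concatenated without a case distinction for empty
    products. *)
Definition wprod (a : int) (k : nat) : K := \prod_(i < k) w (a + i%:Z).

Lemma wprodD a k l : wprod a (k + l) = wprod a k * wprod (a + k%:Z) l.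
Proof.
rewrite /wprod big_split_ord /=; congr (_ * _); apply: eq_bigr => i _.
by rewrite PoszD addrA.
Qed.

Lemma wprodS a k : wprod a k.+1 = w a * wprod (a + 1) k.
Proof. by rewrite -add1n wprodD /wprod big_ord1 addr0. Qed.

Lemma wprod_neq0 a k : wprod a k != 0.
Proof. exact/prodf_neq0. Qed.

Lemma prod_int_wprod a (k : nat) : prod_int w a (a + k%:Z - 1) = wprod a k.
Proof.
rewrite /prod_int; case: k => [|k].
  by rewrite (_ : (a <= a + 0 - 1) = false) ?/wprod ?big_ord0//; lia.
rewrite (_ : (a <= a + k.+1%:Z - 1) = true); last by lia.
by have -> : absz (a + k.+1%:Z - 1 - a)%R = k by lia.
Qed.

Lemma prod_int_wprod1 (n : nat) : prod_int w 1 n%:Z = wprod 1 n.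
Proof. by rewrite -prod_int_wprod; congr prod_int; lia. Qed.

Lemma prod_int_wprod0 (n : nat) : prod_int w (- n%:Z + 1) 0 = wprod (- n%:Z + 1) n.
Proof. by rewrite -prod_int_wprod; congr prod_int; lia. Qed.

End WeightProducts.

(** * Removing finitely many elements from a member of the family *)

Lemma furstenberg_tail (F : set (set nat)) A N :
  furstenberg F -> left_invariant F -> partition_regular F ->
  F A -> F (A `&` [set n | (N <= n)%N]).
Proof.
move=> [_ F0 _] li pr FA.
have E : A = (A `&` [set n | (n < N)%N]) `|` (A `&` [set n | (N <= n)%N]).
  apply/seteqP; split=> n; last by case=> -[].
  by move=> An; case: (ltnP n N) => h; [left|right].
(* The part below [N] cannot belong to [F]: its left shift by [N] is empty. *)
have [h|//] := pr _ _ _ FA E.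
exfalso; apply: F0; have := li _ N h; congr F.
by apply/seteqP; split=> // n [_] /=; lia.
Qed.

(** * Coordinate projections and multipliers in a sequence space with unconditional basis *)

Section SequenceSpace.
Variables (K : numFieldType) (X : tvsType K) (coord : int -> X -> K) (e : int -> X).
Hypotheses (Xf : frechet X) (ssX : sequence_space coord) (ubX : uncond_basis coord e).

Lemma coordD n u v : coord n (u + v) = coord n u + coord n v.
Proof. by case: ssX => + _ _ => /(_ n 1 u v); rewrite scale1r mul1r. Qed.

Lemma coord0 n : coord n 0 = 0.
Proof. by apply: (@addrI _ (coord n 0)); rewrite -coordD !addr0. Qed.

Lemma coordZ n a u : coord n (a *: u) = a * coord n u.
Proof. by case: ssX => + _ _ => /(_ n a u 0); rewrite coord0 !addr0. Qed.

Lemma coord_inj u v : (forall n, coord n u = coord n v) -> u = v.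
Proof. by case: ssX => _ + _; exact. Qed.

Lemma coord_e n k : coord k (e n) = (k == n)%:R.
Proof. by case: ubX. Qed.

Lemma coord_near j y (d : K) : 0 < d -> nbhs y [set z | `|coord j y - coord j z| < d].
Proof.
move=> d0; case: ssX => _ _ cc.
have h : nbhs y (coord j @^-1` ball (coord j y : K^o) d).
  exact: cc (nbhsx_ballx _ _ _).
by apply: filterS h => z; rewrite -ball_normE.
Qed.

Lemma coord_proj_equicontinuous (W : set X) : nbhs 0 W -> exists N : nat,
  exists2 U : set X, nbhs 0 U & forall u q, U u -> (N <= `|q|)%N -> W (coord q u *: e q).
Proof.
apply: frechet_equicontinuous => //.
- by move=> q u v; rewrite coordD scalerDl.
- move=> q u; case: ssX => _ _ /(_ q u) cq.
  apply: (@continuous_comp X (K^o * X)%type X (fun u => (coord q u, e q))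
    (fun z => z.1 *: z.2)); last exact: scale_continuous.
  apply: (@cvg_pair _ _ _ _ (nbhs (coord q u : K^o))); [exact: cq|exact: cvg_cst].
- move=> u V hV; have [N hN] := uncond_sum_tail (ubX.2 u) hV.
  exists N => q hq; have := hN [:: q]; rewrite big_seq1; apply=> //.
  by move=> n; rewrite inE => /eqP->.
Qed.

Lemma bounded_multiplier_cvg (x : X) (A : set nat) (p : nat) (a : nat -> K) (M : K) :
  0 < M -> (forall n, A n -> `|a n| <= M) ->
  exists l : X, (fun N : nat => \sum_(0 <= n < N | n \in A)
     (a n * coord (p%:Z + n%:Z) x) *: e (p%:Z + n%:Z)) @ \oo --> l.
Proof.
move=> M0 ha; set s := (fun N : nat => \sum_(0 <= n < N | n \in A) _).
apply: frechet_additive_cauchy_cvg => // U hU.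
have [c c0 Hc] := bounded_multipliers K.
(* The factor [M] normalises the multipliers [a], and [c] is the multiplier constant of [K]. *)
have [W [hW cbW WU]] := nbhs0_cvx_bal (nbhs0_scale (M * c) hU).
have [N hN] := uncond_sum_tail (ubX.2 x) hW.
exists N.
suff main (n m : nat) : (N <= m)%N -> (m <= n)%N ->
    exists2 u, W u & s n - s m = (M * c) *: u.
  move=> n m hn hm; case: (leqP m n) => mn.
    by have [u Wu ->] := main n m hm mn; exact: WU.
  have [u Wu E] := main m n hn (ltnW mn).
  rewrite -opprB E -scalerN -scaleN1r; apply: WU; apply: cbW.2 => //.
  by rewrite normrN1.
move=> hm mn.
have -> : s n - s m = \sum_(m <= k < n | k \in A) (a k * coord (p%:Z + k%:Z) x) *: e (p%:Z + k%:Z).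
  by rewrite /s (big_cat_nat (leq0n m) mn) /= [X in X - _]addrC addrK.
pose v k := coord (p%:Z + k%:Z) x *: e (p%:Z + k%:Z).
pose b k := if k \in A then a k / M else 0.
have b1 k : `|b k| <= 1.
  rewrite /b; case: ifPn => [/set_mem Ak|_]; last by rewrite normr0.
  by rewrite normrM normfV (gtr0_norm M0) ler_pdivrMr// mul1r ha.
pose G := [seq k <- index_iota m n | k \in A].
have subG H : subseq H G -> W (\sum_(k <- H) v k).
  move=> sH.
  have uH : uniq H by apply: subseq_uniq sH _; rewrite filter_uniq// iota_uniq.
  have := hN (map (fun k : nat => p%:Z + k%:Z) H); rewrite big_map; apply.
    by rewrite map_inj_uniq// => k l /addrI[].
  move=> _ /mapP[k /(mem_subseq sH) + ->].
  by rewrite mem_filter mem_index_iota => /andP[_ /andP[mk _]]; lia.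
have [u Wu E] := Hc X W cbW _ G v b subG b1.
exists u => //; rewrite -scalerA -E scaler_sumr big_filter.
by apply: eq_bigr => k kA; rewrite /b kA !scalerA; congr (_ *: _); field; rewrite gt_eqF.
Qed.

End SequenceSpace.

(** * Recurrence of the weighted shift *)

Section WeightedShift.
Variables (K : numFieldType) (X : tvsType K) (coord : int -> X -> K) (e : int -> X).
Variables (w : int -> K) (B : X -> X).
Hypotheses (Xf : frechet X) (ssX : sequence_space coord) (ubX : uncond_basis coord e).
Hypotheses (w0 : forall n, w n != 0) (wB : is_weighted_backward_shift coord w B).

Lemma coord_iter k n x : coord n (iter k B x) = wprod w (n + 1) k * coord (n + k%:Z) x.
Proof.
elim: k n => [|k IH] n; first by rewrite /wprod big_ord0 mul1r addr0.
rewrite iterS wB.1 IH wprodS mulrA; congr (_ * coord _ _); lia.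
Qed.

Lemma iter_shift_e k q a :
  iter k B (a *: e q) = (a * wprod w (q - k%:Z + 1) k) *: e (q - k%:Z).
Proof.
apply: (coord_inj ssX) => n.
rewrite coord_iter !(coordZ ssX) !(coord_e ubX).
have -> : (n + k%:Z == q) = (n == q - k%:Z) by rewrite eq_sym -subr_eq eq_sym.
case: eqP => [->|_]; first by rewrite !mulr1 mulrC.
by rewrite !mulr0.
Qed.

Lemma iter_shift_continuous k : continuous (iter k B).
Proof.
elim: k => [|k IH] x; first exact: cvg_id.
by apply: continuous_comp; [exact: IH|exact: wB.2].
Qed.

Lemma nbhs0_iter_shift k (W : set X) : nbhs 0 W -> nbhs 0 [set u | W (iter k B u)].
Proof.
move=> hW; apply: (iter_shift_continuous (k := k) (x := 0)).
have -> // : iter k B 0 = 0.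
by apply: (coord_inj ssX) => n; rewrite coord_iter !(coord0 ssX) mulr0.
Qed.

Variable F : set (set nat).
Hypotheses (Ff : furstenberg F) (Fl : left_invariant F) (Fp : partition_regular F).

Definition recurrence_conclusion (p : nat) (W : set X) := exists A : set nat,
    [/\ F A,
        exists l : X, (fun N : nat =>
                \sum_(0 <= n < N | n \in A)
                   (prod_int w 1 (p%:Z + n%:Z))^-1 *: e (p%:Z + n%:Z)) @ \oo --> l
      & forall n : nat, A n -> (p <= n)%N ->
          W (prod_int w (p%:Z - n%:Z + 1) 0 *: e (p%:Z - n%:Z))].

(** The case of a nonzero coordinate of [y] at a position [j <= p]. *)
Lemma recurrence_below (x y : X) (j : int) (s p : nat) : j + s%:Z = p%:Z ->
  coord j y != 0 -> (forall V, nbhs y V -> F [set n | V (iter n B x)]) ->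
  forall W, nbhs 0 W -> recurrence_conclusion p W.
Proof.
move=> jsp yj HF W hW.
pose h := `|coord j y| / 2%:R.
have h0 : 0 < h by rewrite divr_gt0 ?normr_gt0.
pose V0 := [set z | `|coord j y - coord j z| < h].
have V0h z : V0 z -> h < `|coord j z|.
  move=> hz; rewrite -(ltrD2l h) (_ : h + h = `|coord j y|); last by rewrite /h; field.
  rewrite -[X in `|X|](subrK (coord j z)); apply: le_lt_trans (ler_normD _ _) _.
  by rewrite ltrD2r.
have hV0 : nbhs y V0 by exact: coord_near.
(* A return time [m >= 2s] keeps the shift count [c = m - 2s] free of truncation; with
   [q = j + m - (n + s)] one gets [q - c = p - n]. *)
have [m [hm ms]] : ([set n | V0 (iter n B x)] `&` [set n | (s + s <= n)%N]) !=set0.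
  apply/set0P/eqP => E; case: Ff => _ F0 _; apply: F0; rewrite -E.
  by apply: furstenberg_tail => //; exact: HF.
pose b := coord j (iter m B x).
have b0 : b != 0 by rewrite -normr_gt0; apply: lt_trans h0 (V0h _ hm).
pose c := (m - (s + s))%N.
(* Since [p - s = j], this factor trades the block [w_{1-s} ... w_j] for [w_{1-s} ... w_0], so the
   product ends at index 0. *)
pose k2 := wprod w (1 - s%:Z) s / wprod w (1 - s%:Z) p.
have hW1 : nbhs 0 [set u | W (k2 *: iter c B (b^-1 *: u))].
  by have := nbhs0_scale b^-1 (nbhs0_iter_shift c (nbhs0_scale k2 hW)).
have [W2 hW2 W21] := nbhs0_split hW1.
have [N1 [U hU HU]] := coord_proj_equicontinuous Xf ssX ubX hW2.
have [N2 HN2] := uncond_sum_tail (ubX.2 y) hW2.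
pose A := [set n | (V0 `&` [set z | U (z - y)]) (iter n B x)].
have FA : F A by apply: HF; apply: filterI => //; exact: nbhs_subr.
(* Beyond this index [|q|] exceeds [N1] and [N2], and the natural subtractions below are exact. *)
pose N3 := (`|j| + m + N1 + N2 + p + s)%N.
pose A' := [set k | A (k + s)%N] `&` [set k | (N3 <= k)%N].
have FA' : F A' by apply: furstenberg_tail => //; exact: Fl.
exists A'; split=> //.
  (* As [d n = w_{j+1} ... w_{p+n} x_{p+n}], the factor [kp] corrects the starting index: [(w_1 ...
     w_{p+n})^-1 = (kp / d n) x_{p+n}]. *)
  pose kp := wprod w (j + 1) s / wprod w 1 p.
  have kp0 : kp != 0 by rewrite mulf_neq0 ?invr_eq0 ?wprod_neq0.
  pose d n := coord j (iter (n + s) B x).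
  have dh n : A' n -> h < `|d n| by move=> [[hn _] _]; exact: V0h.
  have M0 : 0 < `|kp| / h by rewrite divr_gt0 ?normr_gt0.
  have ha n : A' n -> `|kp / d n| <= `|kp| / h.
    move=> /dh hn; rewrite normrM normfV ler_pM2l ?normr_gt0// lef_pV2 ?posrE//.
      exact: ltW.
    exact: lt_trans hn.
  have [l hl] := bounded_multiplier_cvg Xf ubX x p M0 ha.
  exists l; rewrite (_ : (fun N : nat => _) = (fun N : nat => \sum_(0 <= n < N | n \in A')
     (kp / d n * coord (p%:Z + n%:Z) x) *: e (p%:Z + n%:Z)))//.
  apply/funext => N; apply: eq_bigr => n /set_mem An; congr (_ *: _).
  have dn : d n != 0 by rewrite -normr_gt0; apply: lt_trans h0 (dh _ An).
  move: dn; rewrite /d coord_iter addnC wprodD.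
  rewrite (_ : j + 1 + s%:Z = 1 + p%:Z); last by lia.
  rewrite (_ : j + (s + n)%N%:Z = p%:Z + n%:Z); last by lia.
  rewrite -PoszD prod_int_wprod1 wprodD => dn.
  have xn : coord (p + n)%N%:Z x != 0 by apply: contra_neq dn => ->; rewrite mulr0.
  rewrite /kp; move: (wprod_neq0 w0 (j + 1) s) (wprod_neq0 w0 (1 + p%:Z) n).
  move: (wprod_neq0 w0 1 p) xn.
  move: (wprod _ _ _) (wprod _ _ _) (wprod _ _ _) (coord _ _) => c1 c2 c3 c4 h1 h2 h3 h4.
  by field; rewrite h1 h2 h3 h4.
move=> n [[hnV hnU] hN3] pn; rewrite /= in hnV hnU hN3.
pose q := j + m%:Z - (n + s)%N%:Z.
have hq1 : (N1 <= `|q|)%N by rewrite /q /N3 in hN3 *; lia.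
have hq2 : (N2 <= `|q|)%N by rewrite /q /N3 in hN3 *; lia.
(* The [q]-th coordinate term of [B^(n+s) x - y] is small by equicontinuity, that of [y] by
   convergence of its expansion. *)
have W1q : W (k2 *: iter c B (b^-1 *: (coord q (iter (n + s) B x) *: e q))).
  have h1 := HU _ q hnU hq1.
  have h2 : W2 (coord q y *: e q).
    have := HN2 [:: q]; rewrite big_seq1; apply=> //.
    by move=> k; rewrite inE => /eqP->.
  have := W21 _ _ h1 h2; rewrite -scalerDl -(coordD ssX) subrK; exact.
move: W1q; rewrite coord_iter scalerA iter_shift_e scalerA.
pose r := (n - p - s)%N.
have qc : q - c%:Z = p%:Z - n%:Z by rewrite /q /c /= in ms *; lia.
rewrite qc (_ : p%:Z - n%:Z = - (n - p)%N%:Z); last by lia.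
rewrite prod_int_wprod0.
have bE : b = wprod w (j + 1) m * coord (j + m%:Z) x by exact: coord_iter.
set coef := _ * _; suff -> : coef = wprod w (- (n - p)%N%:Z + 1) (n - p) by [].
rewrite /coef (_ : q + (n + s)%N%:Z = j + m%:Z); last by rewrite /q; lia.
(* Splits the weights at [j]: the last [m] of them, times [x_{j+m}], make up the constant [b], which
   cancels. *)
rewrite (_ : (n + s)%N = (n + s - m + m)%N); last by rewrite /N3 in hN3; lia.
rewrite wprodD (_ : q + 1 + (n + s - m)%N%:Z = j + 1); last by rewrite /q /N3 in hN3 *; lia.
rewrite -[wprod w (q + 1) _ * _ * _]mulrA -bE.
have e1 : wprod w (q + 1) (n + s - m) * wprod w (- (n - p)%N%:Z + 1) c =
    wprod w (- (n - p)%N%:Z + 1) r * wprod w (1 - s%:Z) p.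
  rewrite mulrC (_ : q + 1 = - (n - p)%N%:Z + 1 + c%:Z); last by move: qc; lia.
  rewrite -wprodD (_ : (c + (n + s - m))%N = (r + p)%N); last first.
    by rewrite /c /r /N3 /= in ms hN3 *; lia.
  by rewrite wprodD; congr (_ * wprod _ _ _); rewrite /r /N3 in hN3 *; lia.
have e2 : wprod w (- (n - p)%N%:Z + 1) (n - p) =
    wprod w (- (n - p)%N%:Z + 1) r * wprod w (1 - s%:Z) s.
  rewrite {2}(_ : (n - p)%N = (r + s)%N); last by rewrite /r /N3 in hN3 *; lia.
  by rewrite wprodD; congr (_ * wprod _ _ _); rewrite /r /N3 in hN3 *; lia.
rewrite e2 -[X in k2 * X]mulrA [X in b^-1 * X]mulrAC e1 [X in k2 * X]mulrC.
rewrite mulfK// /k2; field.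
exact: wprod_neq0.
Qed.

End WeightedShift.

(** * Reduction to a nonzero coordinate at or below [p] *)

Theorem theorem3p1 (K : numFieldType) (X : tvsType K)
    (coord : int -> X -> K) (e : int -> X) (w : int -> K) (B : X -> X)
    (F : set (set nat)) :
  frechet X ->
  sequence_space coord ->
  uncond_basis coord e ->
  (forall n, w n != 0) ->
  is_weighted_backward_shift coord w B ->
  furstenberg F -> left_invariant F -> partition_regular F ->
  (exists (x y : X), y != 0 /\
     forall V, nbhs y V -> F [set n | V (iter n B x)]) ->
  forall (p : nat) (W : set X), nbhs 0 W ->
  exists A : set nat,
    [/\ F A,
        exists l : X, (fun N : nat =>
                \sum_(0 <= n < N | n \in A)
                   (prod_int w 1 (p%:Z + n%:Z))^-1 *: e (p%:Z + n%:Z)) @ \oo --> l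
      & forall n : nat, A n -> (p <= n)%N ->
          W (prod_int w (p%:Z - n%:Z + 1) 0 *: e (p%:Z - n%:Z))].
Proof.
move=> Xf ssX ubX w0 wB Ff Fl Fp [x [y [y0 HF]]] p W hW.
have [j yj] : exists j, coord j y != 0.
  apply: contrapT => /forallNP hn; move/eqP: y0; apply.
  apply: (coord_inj ssX) => n; rewrite (coord0 ssX).
  by have /negP := hn n; rewrite negbK => /eqP.
have [jp|pj] := lerP j p%:Z.
  apply: (recurrence_below Xf ssX ubX w0 wB Ff Fl Fp (j := j) (s := `|p%:Z - j|%N)) HF _ hW => //.
  lia.
(* If [j > p], applying [B^d] to [x] and [y] moves the nonzero coordinate from [j] to [p]; by
   continuity of [B^d] the return sets stay in [F]. *)
pose d := `|j - p%:Z|%N.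
have jE : p%:Z + d%:Z = j by rewrite /d; lia.
apply: (recurrence_below Xf ssX ubX w0 wB Ff Fl Fp (x := iter d B x) (y := iter d B y)
  (j := p%:Z) (s := 0%N)) hW; first by rewrite addr0.
  by rewrite (coord_iter wB) jE mulf_neq0// wprod_neq0.
move=> V hV; have := HF _ (iter_shift_continuous wB (k := d) hV); congr F.
by apply/seteqP; split=> n /=; rewrite -!iterD addnC.
Qed.
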